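(* The infinite series \[ \sum_{n=1}^\infty \frac{\left(\frac{2}{3} + \frac{1}{3} \sin n\right)^n}{n} \] converges.
   Context: Here $n$ ranges over the positive integers and $\sin n$ is the sine of the real number $n$ (in radians). *)

(* Defs.v *)
From Stdlib Require Export Reals.
From Coquelicot Require Export Coquelicot.

Open Scope R_scope.

(* Main.v *)
(* The [n]-th term is summably small unless [n] is close to [PI / 2] modulo [2 * PI].  Two such
   exceptional indices differ by some [h] that is very close to a multiple of [2 * PI], so it
   suffices to know that [|h - 2 PI k| >= exp (- C h^(2/3))]: the gap after an exceptional [n]
   is then at least of order [(ln n)^(3/2)], and [sum 1 / (n (ln n)^(3/2))] converges.

   The Diophantine bound comes from Hermite-Pade approximants to [1, cos, sin].  Start from the
   constant 1 and alternately solve [y'' + y = f] and [y' = f] with zero initial data.  After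
   [n] rounds this gives [f = A + B cos + C sin] with [A, B, C] of degree at most [n], whose
   denominators divide [8^n n!], while [f x] is of size [x^(3n) / (3n)!] on [[0, PI / 2]].
   Hence [8^n n! f (PI / 2)] is the value at [PI / 2] of an integer polynomial of degree [n], and
   it is positive and at most about [n^(- 2 n)].  Comparing with the value at a rational [p / q],
   a multiple of [q^(- n)], with [n] of order [sqrt q], bounds [|p / q - PI / 2|] below by
   [exp (- C sqrt q ln q)]. *)
Require Import Defs.
From Stdlib Require Import Reals.
From Coquelicot Require Import Coquelicot.
From Stdlib Require Import Lra Lia Psatz ZArith Arith.
Open Scope R_scope.

(** * Hermite-Pade approximants to 1, cos, sin *)

(** Divided powers: differentiation lowers the index without a factor, so solving the two equations
    creates only powers of 2 as new denominators. *)
Definition divpow (k : nat) (x : R) : R := x ^ k / INR (fact k).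

Inductive trig := One | Cos | Sin.

Definition trig_fun (t : trig) (x : R) : R :=
  match t with One => 1 | Cos => cos x | Sin => sin x end.

Definition mono (k : nat) (t : trig) (x : R) : R := divpow k x * trig_fun t x.

(* That is, [c] is an integer multiple of [2 ^ (k - N)]. *)
Definition dyadic (N k : nat) (c : R) : Prop :=
  exists z : Z, c * 2 ^ N = IZR z * 2 ^ k.

Definition deg (a b : nat) (t : trig) : nat :=
  match t with One => a | _ => b end.

(* [f = A + B cos + C sin] with polynomials of degrees [deg A <= a] and [deg B, deg C <= b];
   the coefficients of [x ^ k / k!] have denominators dividing [2 ^ (N - k)], and the sum
   of their absolute values is at most [w]. *)
Inductive span (N a b : nat) : R -> (R -> R) -> Prop :=
| span_nil w f : 0 <= w -> (forall x, f x = 0) -> span N a b w f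
| span_cons w v f g c k t :
    span N a b w f -> (k <= deg a b t)%nat -> dyadic N k c ->
    w + Rabs c <= v -> (forall x, g x = f x + c * mono k t x) ->
    span N a b v g.

Lemma dyadic_weaken (N M k : nat) (c : R) :
  (N <= M)%nat -> dyadic N k c -> dyadic M k c.
Proof.
intros H [z Hz]. exists (z * 2 ^ Z.of_nat (M - N))%Z.
replace M with (N + (M - N))%nat at 1 by lia.
rewrite mult_IZR, pow_add, <- pow_IZR.
rewrite <- Rmult_assoc, Hz. ring.
Qed.

Lemma dyadic_lower (N k : nat) (c : R) : dyadic N (S k) c -> dyadic N k c.
Proof.
intros [z Hz]. exists (2 * z)%Z. rewrite Hz, mult_IZR. simpl. ring.
Qed.

Lemma dyadic_opp (N k : nat) (c : R) : dyadic N k c -> dyadic N k (- c).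
Proof.
intros [z Hz]. exists (- z)%Z. rewrite opp_IZR.
replace (- c * 2 ^ N) with (- (c * 2 ^ N)) by ring. rewrite Hz. ring.
Qed.

Lemma dyadic_raise (N k : nat) (c : R) : dyadic N k c -> dyadic (S N) (S k) c.
Proof. intros [z Hz]. exists z. simpl. nra. Qed.

Lemma dyadic_half (N k : nat) (c : R) : dyadic N k c -> dyadic (S N) k (c / 2).
Proof. intros [z Hz]. exists z. rewrite <- Hz. simpl. field. Qed.

Lemma dyadic_half_lower (N k : nat) (c : R) :
  dyadic N (S k) c -> dyadic N k (c / 2).
Proof. intros [z Hz]. exists z. simpl in Hz. nra. Qed.

Lemma span_weight_ge0 N a b w f : span N a b w f -> 0 <= w.
Proof.
induction 1; [assumption|].
pose proof (Rabs_pos c). lra.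
Qed.

Lemma span_ext N a b w f g :
  span N a b w f -> (forall x, g x = f x) -> span N a b w g.
Proof.
intros H E; destruct H.
- apply span_nil; [assumption|]. intros x; rewrite E; auto.
- eapply span_cons; eauto. intros x; rewrite E; auto.
Qed.

Lemma span_weaken N a b w M a' b' v f :
  (N <= M)%nat -> (a <= a')%nat -> (b <= b')%nat -> w <= v ->
  span N a b w f -> span M a' b' v f.
Proof.
intros HN Ha Hb Hw H; revert v Hw; induction H; intros v' Hv.
- apply span_nil; auto; lra.
- apply (span_cons M a' b' w v' f g c k t); auto.
  + apply IHspan; lra.
  + destruct t; simpl in *; lia.
  + eapply dyadic_weaken; eauto.
  + lra.
Qed.

Lemma span_mono N a b k t c :
  (k <= deg a b t)%nat -> dyadic N k c ->
  span N a b (Rabs c) (fun x => c * mono k t x).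
Proof.
intros Hk Hc.
apply (span_cons N a b 0 _ (fun _ => 0) _ c k t); auto.
- apply span_nil; auto; lra.
- lra.
- intros x; ring.
Qed.

(** * Primitives and forced oscillations with zero initial data *)

Definition is_primitive (f F : R -> R) : Prop :=
  F 0 = 0 /\ forall x, is_derive F x (f x).

(** This is [F'' + F = f] with [F 0 = F' 0 = 0], where [F1] stands for [F']. *)
Definition is_oscillation (f F : R -> R) : Prop :=
  exists F1 : R -> R, F 0 = 0 /\ F1 0 = 0 /\
    (forall x, is_derive F x (F1 x)) /\ (forall x, is_derive F1 x (f x - F x)).

Lemma primitive_plus f g F G :
  is_primitive f F -> is_primitive g G ->
  is_primitive (fun x => f x + g x) (fun x => F x + G x).
Proof.
intros [F0 HF] [G0 HG]; split; [lra|].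
intros x; apply (is_derive_plus F G); auto.
Qed.

Lemma oscillator_plus f g F G :
  is_oscillation f F -> is_oscillation g G ->
  is_oscillation (fun x => f x + g x) (fun x => F x + G x).
Proof.
intros (F1 & F0 & F10 & HF & HF1) (G1 & G0 & G10 & HG & HG1).
exists (fun x => F1 x + G1 x); split; [|split; [|split]]; try lra; intros x.
- apply (is_derive_plus F G); auto.
- replace (f x + g x - (F x + G x)) with (plus (f x - F x) (g x - G x)).
  + apply (is_derive_plus F1 G1); auto.
  + unfold plus; simpl; ring.
Qed.

Lemma primitive_ext f g F G :
  (forall x, f x = g x) -> (forall x, F x = G x) -> is_primitive f F -> is_primitive g G.
Proof.
intros Ef EF [F0 HF]; split; [now rewrite <- EF|].
intros x; rewrite <- Ef; apply (is_derive_ext F); auto.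
Qed.

Lemma oscillator_ext f g F G :
  (forall x, f x = g x) -> (forall x, F x = G x) -> is_oscillation f F -> is_oscillation g G.
Proof.
intros Ef EF (F1 & F0 & F10 & HF & HF1).
exists F1; split; [|split; [|split]]; auto.
- now rewrite <- EF.
- intros x; apply (is_derive_ext F); auto.
- intros x; rewrite <- Ef, <- EF; auto.
Qed.

Lemma is_derive_divpow_S k x : is_derive (divpow (S k)) x (divpow k x).
Proof.
unfold divpow. auto_derive; [trivial|].
change (match k with 0%nat => 1 | S _ => INR k + 1 end) with (INR (S k)).
rewrite S_INR, plus_INR, mult_INR.
field. pose proof (INR_fact_lt_0 k). pose proof (pos_INR k). split; nra.
Qed.

Lemma divpow_0 x : divpow 0 x = 1.
Proof. unfold divpow; simpl; field. Qed.

Lemma divpow_S_at_0 k : divpow (S k) 0 = 0.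
Proof. unfold divpow; simpl; unfold Rdiv; ring. Qed.

Lemma is_derive_divpow_0 x : is_derive (divpow 0) x 0.
Proof.
apply (is_derive_ext (fun _ => 1)); [intros y; now rewrite divpow_0|].
apply (is_derive_const (1 : R)).
Qed.

Lemma ex_derive_divpow k x : ex_derive (divpow k) x.
Proof.
destruct k; eexists; [apply is_derive_divpow_0 | apply is_derive_divpow_S].
Qed.

Ltac der_divpow :=
  auto_derive;
  [ repeat match goal with
    | |- _ /\ _ => split
    | |- True => exact I
    | |- ex_derive _ _ => apply ex_derive_divpow
    end
  | repeat match goal with
    | |- context [Derive (fun x => divpow (S ?k) x) ?y] =>
        replace (Derive (fun x => divpow (S k) x) y) with (divpow k y)
          by (symmetry; apply is_derive_unique, is_derive_divpow_S)
    | |- context [Derive (fun x => divpow 0 x) ?y] =>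
        replace (Derive (fun x => divpow 0 x) y) with 0
          by (symmetry; apply is_derive_unique, is_derive_divpow_0)
    end ].

(** * Explicit solutions inside [span]: degrees, denominators and weights *)

Lemma span_plus N a b w1 w2 f g :
  span N a b w1 f -> span N a b w2 g -> span N a b (w1 + w2) (fun x => f x + g x).
Proof.
intros Hf Hg; revert w1 f Hf.
induction Hg as [w g Hw Hg | w v g h c k t Hg IH Hk Hc Hw Hh]; intros w1 f Hf.
- apply (span_ext N a b (w1 + w) f).
  + eapply span_weaken; [| | | |exact Hf]; auto; lra.
  + intros x; rewrite Hg; ring.
- eapply (span_cons N a b (w1 + w) _ (fun x => f x + g x) _ c k t); auto.
  + lra.
  + intros x; rewrite Hh; ring.
Qed.

Lemma primitive_mono_one N a b k c :
  (k <= a)%nat -> dyadic N k c ->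
  exists F, span (S N) (S a) b (Rabs c * (INR k + 2)) F /\
    is_primitive (fun x => c * mono k One x) F.
Proof.
intros Hk Hc; pose proof (Rabs_pos c); pose proof (pos_INR k).
exists (fun x => c * mono (S k) One x); split.
- apply (span_weaken (S N) (S a) b (Rabs c)); auto; [nra|].
  apply span_mono; [simpl; lia | now apply dyadic_raise].
- split; unfold mono; simpl trig_fun.
  + rewrite divpow_S_at_0; ring.
  + intros x; der_divpow; ring.
Qed.

(** Integration by parts moves the coefficient, up to sign, from [x^k / k!] to [x^(k-1) / (k-1)!]
    and swaps cosine and sine, so both descend together. Each step adds [Rabs c] to the weight, and
    the base case [1 - cos] costs [2 * Rabs c]. *)
Lemma primitive_mono_trig N a b k : forall c, (k <= b)%nat -> dyadic N k c ->
  (exists F, span (S N) (S a) b (Rabs c * (INR k + 2)) F /\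
    is_primitive (fun x => c * mono k Cos x) F) /\
  (exists F, span (S N) (S a) b (Rabs c * (INR k + 2)) F /\
    is_primitive (fun x => c * mono k Sin x) F).
Proof.
induction k as [|k IH]; intros c Hk Hc; pose proof (Rabs_pos c) as Hpos.
- split.
  + exists (fun x => c * mono 0 Sin x); split.
    * apply (span_weaken N a b (Rabs c)); auto; [simpl; lra|].
      now apply span_mono.
    * split; unfold mono; simpl trig_fun.
      -- rewrite sin_0; ring.
      -- intros x; rewrite divpow_0; der_divpow; rewrite !divpow_0; ring.
  + exists (fun x => c * mono 0 One x + - c * mono 0 Cos x); split.
    * apply (span_weaken N a b (Rabs c + Rabs (- c))); auto.
      -- rewrite Rabs_Ropp; simpl; lra.
      -- apply (span_plus N a b _ _ (fun x => c * mono 0 One x)); apply span_mono;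
           simpl; try lia; auto using dyadic_opp.
    * split; unfold mono; simpl trig_fun.
      -- rewrite cos_0; ring.
      -- intros x; rewrite divpow_0; der_divpow; rewrite !divpow_0; ring.
- assert (Hc' := dyadic_opp _ _ _ Hc).
  assert (HI : INR (S k) = INR k + 1) by apply S_INR.
  split.
  + destruct (IH (- c)) as [_ [F [HF PF]]]; [lia | now apply dyadic_lower |].
    exists (fun x => c * mono (S k) Sin x + F x); split.
    * apply (span_weaken (S N) (S a) b (Rabs c + Rabs (- c) * (INR k + 2))); auto.
      -- rewrite Rabs_Ropp, HI; lra.
      -- apply (span_plus _ _ _ _ _ (fun x => c * mono (S k) Sin x)); auto.
         apply (span_weaken N a b (Rabs c)); auto; [lra|]. now apply span_mono.
    * destruct PF as [F0 PF]; split.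
      -- unfold mono; rewrite F0, divpow_S_at_0; ring.
      -- intros x.
         replace (c * mono (S k) Cos x) with
           (plus (c * mono k Sin x + c * mono (S k) Cos x) (- c * mono k Sin x))
           by (unfold plus; simpl; ring).
         apply (is_derive_plus (fun x => c * mono (S k) Sin x) F); auto.
         unfold mono; simpl trig_fun; der_divpow; ring.
  + destruct (IH c) as [[F [HF PF]] _]; [lia | now apply dyadic_lower |].
    exists (fun x => - c * mono (S k) Cos x + F x); split.
    * apply (span_weaken (S N) (S a) b (Rabs (- c) + Rabs c * (INR k + 2))); auto.
      -- rewrite Rabs_Ropp, HI; lra.
      -- apply (span_plus _ _ _ _ _ (fun x => - c * mono (S k) Cos x)); auto.
         apply (span_weaken N a b (Rabs (- c))); auto; [lra|]. now apply span_mono.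
    * destruct PF as [F0 PF]; split.
      -- unfold mono; rewrite F0, divpow_S_at_0; ring.
      -- intros x.
         replace (c * mono (S k) Sin x) with
           (plus (- c * mono k Cos x + c * mono (S k) Sin x) (c * mono k Cos x))
           by (unfold plus; simpl; ring).
         apply (is_derive_plus (fun x => - c * mono (S k) Cos x) F); auto.
         unfold mono; simpl trig_fun; der_divpow; ring.
Qed.

(* Two steps down at a time: [(D^2 + 1) (x^(k+2)/(k+2)!) = x^(k+2)/(k+2)! + x^k/k!]. *)
Lemma oscillator_mono_one N a b k : forall c, (k <= a)%nat -> dyadic N k c ->
  exists F, span (S (S N)) a (S b) (Rabs c * (INR k + 2)) F /\
    is_oscillation (fun x => c * mono k One x) F.
Proof.
induction k as [k IH] using (well_founded_induction lt_wf); intros c Hk Hc.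
pose proof (Rabs_pos c) as Hpos.
destruct k as [|[|k]].
- exists (fun x => c * mono 0 One x + - c * mono 0 Cos x); split.
  + apply (span_weaken N a b (Rabs c + Rabs (- c))); auto.
    * rewrite Rabs_Ropp; simpl; lra.
    * apply (span_plus N a b _ _ (fun x => c * mono 0 One x)); apply span_mono;
        simpl; try lia; auto using dyadic_opp.
  + exists (fun x => c * sin x); split; [|split; [|split]]; unfold mono; simpl trig_fun.
    * rewrite cos_0; ring.
    * rewrite sin_0; ring.
    * intros x; der_divpow; rewrite !divpow_0; ring.
    * intros x; der_divpow; rewrite !divpow_0; ring.
- exists (fun x => c * mono 1 One x + - c * mono 0 Sin x); split.
  + apply (span_weaken N a b (Rabs c + Rabs (- c))); auto.
    * rewrite Rabs_Ropp; simpl; lra.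
    * apply (span_plus N a b _ _ (fun x => c * mono 1 One x)); apply span_mono;
        simpl; try lia; auto using dyadic_opp, dyadic_lower.
  + exists (fun x => c * (1 - cos x)); split; [|split; [|split]]; unfold mono; simpl trig_fun.
    * rewrite sin_0, divpow_S_at_0; ring.
    * rewrite cos_0; ring.
    * intros x; der_divpow; rewrite !divpow_0; ring.
    * intros x; der_divpow; rewrite !divpow_0; ring.
- destruct (IH k ltac:(lia) (- c)) as [F [HF (F1 & F0 & F10 & DF & DF1)]]; [lia | |].
  { now apply dyadic_opp, dyadic_lower, dyadic_lower. }
  exists (fun x => c * mono (S (S k)) One x + F x); split.
  + apply (span_weaken (S (S N)) a (S b) (Rabs c + Rabs (- c) * (INR k + 2))); auto.
    * rewrite Rabs_Ropp, !S_INR; lra.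
    * apply (span_plus _ _ _ _ _ (fun x => c * mono (S (S k)) One x)); auto.
      apply (span_weaken N a b (Rabs c)); auto; [lra|]. now apply span_mono.
  + exists (fun x => c * divpow (S k) x + F1 x); split; [|split; [|split]].
    * unfold mono; rewrite F0, divpow_S_at_0; ring.
    * rewrite F10, divpow_S_at_0; ring.
    * intros x; unfold mono; simpl trig_fun.
      apply (is_derive_plus (fun x => c * (divpow (S (S k)) x * 1)) F); auto.
      der_divpow; ring.
    * intros x.
      replace (_ - _) with (plus (c * divpow k x) (- c * mono k One x - F x))
        by (unfold plus, mono; simpl; ring).
      apply (is_derive_plus (fun x => c * divpow (S k) x) F1); auto.
      der_divpow; ring.
Qed.

(* [(D^2 + 1) (x^(k+1)/(k+1)! * sin x) = 2 x^k/k! * cos x + x^(k-1)/(k-1)! * sin x], and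
   likewise with [cos] and [- sin]. *)
Lemma oscillator_mono_trig N a b k : forall c, (k <= b)%nat -> dyadic N k c ->
  (exists F, span (S (S N)) a (S b) (Rabs c) F /\
    is_oscillation (fun x => c * mono k Cos x) F) /\
  (exists F, span (S (S N)) a (S b) (Rabs c) F /\
    is_oscillation (fun x => c * mono k Sin x) F).
Proof.
induction k as [|k IH]; intros c Hk Hc; pose proof (Rabs_pos c) as Hpos;
  assert (Habs : Rabs (c / 2) = Rabs c / 2)
    by (unfold Rdiv; rewrite Rabs_mult, (Rabs_right (/ 2)); lra);
  (* Halving the coefficient costs one power of 2 and raising the index another, which is why [N]
     grows by two. *)
  assert (Hc2 := dyadic_raise _ _ _ (dyadic_half _ _ _ Hc));
  assert (Hc2' := dyadic_opp _ _ _ Hc2).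
- split.
  + exists (fun x => c / 2 * mono 1 Sin x); split.
    * apply (span_weaken (S (S N)) a (S b) (Rabs (c / 2))); auto; [lra|].
      apply span_mono; auto; simpl; lia.
    * exists (fun x => c / 2 * (sin x + divpow 1 x * cos x));
        split; [|split; [|split]]; unfold mono; simpl trig_fun.
      -- rewrite sin_0; ring.
      -- rewrite sin_0, divpow_S_at_0; ring.
      -- intros x; der_divpow; rewrite !divpow_0; ring.
      -- intros x; der_divpow; rewrite !divpow_0; field.
  + exists (fun x => - (c / 2) * mono 1 Cos x + c / 2 * mono 0 Sin x); split.
    * apply (span_weaken (S (S N)) a (S b) (Rabs (- (c / 2)) + Rabs (c / 2))); auto.
      -- rewrite Rabs_Ropp; lra.
      -- apply (span_plus _ _ _ _ _ (fun x => - (c / 2) * mono 1 Cos x)); apply span_mono;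
           simpl; try lia; auto using dyadic_lower.
    * exists (fun x => c / 2 * (divpow 1 x * sin x));
        split; [|split; [|split]]; unfold mono; simpl trig_fun.
      -- rewrite sin_0, divpow_S_at_0; ring.
      -- rewrite sin_0; ring.
      -- intros x; der_divpow; rewrite !divpow_0; ring.
      -- intros x; der_divpow; rewrite !divpow_0; field.
(* The correction term sits one index lower, where [c / 2] is still admissible at level [N]; its
   weight [Rabs c / 2] keeps the total at [Rabs c]. *)
- assert (Hl : dyadic N k (c / 2)) by now apply dyadic_half_lower.
  split.
  + destruct (IH (- (c / 2))) as [_ [F [HF (F1 & F0 & F10 & DF & DF1)]]];
      [lia | now apply dyadic_opp |].
    exists (fun x => c / 2 * mono (S (S k)) Sin x + F x); split.
    * apply (span_weaken (S (S N)) a (S b) (Rabs (c / 2) + Rabs (- (c / 2)))); auto.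
      -- rewrite Rabs_Ropp; lra.
      -- apply (span_plus _ _ _ _ _ (fun x => c / 2 * mono (S (S k)) Sin x)); auto.
         apply span_mono; auto; simpl; lia.
    * exists (fun x => c / 2 * (divpow (S k) x * sin x + divpow (S (S k)) x * cos x) + F1 x);
        split; [|split; [|split]].
      -- unfold mono; rewrite F0, divpow_S_at_0; ring.
      -- rewrite F10, !divpow_S_at_0; ring.
      -- intros x; unfold mono; simpl trig_fun.
         apply (is_derive_plus (fun x => c / 2 * (divpow (S (S k)) x * sin x)) F); auto.
         der_divpow; ring.
      -- intros x.
         replace (_ - _) with
           (plus (c / 2 * (divpow k x * sin x + 2 * divpow (S k) x * cos x
                           - divpow (S (S k)) x * sin x))
                 (- (c / 2) * mono k Sin x - F x))
           by (unfold plus, mono; simpl; field).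
         apply (is_derive_plus (fun x =>
           c / 2 * (divpow (S k) x * sin x + divpow (S (S k)) x * cos x)) F1); auto.
         der_divpow; ring.
  + destruct (IH (c / 2)) as [[F [HF (F1 & F0 & F10 & DF & DF1)]] _]; [lia | auto |].
    exists (fun x => - (c / 2) * mono (S (S k)) Cos x + F x); split.
    * apply (span_weaken (S (S N)) a (S b) (Rabs (- (c / 2)) + Rabs (c / 2))); auto.
      -- rewrite Rabs_Ropp; lra.
      -- apply (span_plus _ _ _ _ _ (fun x => - (c / 2) * mono (S (S k)) Cos x)); auto.
         apply span_mono; auto; simpl; lia.
    * exists (fun x =>
        - (c / 2) * (divpow (S k) x * cos x - divpow (S (S k)) x * sin x) + F1 x);
        split; [|split; [|split]].
      -- unfold mono; rewrite F0, divpow_S_at_0; ring.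
      -- rewrite F10, !divpow_S_at_0; ring.
      -- intros x; unfold mono; simpl trig_fun.
         apply (is_derive_plus (fun x => - (c / 2) * (divpow (S (S k)) x * cos x)) F); auto.
         der_divpow; ring.
      -- intros x.
         replace (_ - _) with
           (plus (- (c / 2) * (divpow k x * cos x - 2 * divpow (S k) x * sin x
                           - divpow (S (S k)) x * cos x))
                 (c / 2 * mono k Cos x - F x))
           by (unfold plus, mono; simpl; field).
         apply (is_derive_plus (fun x =>
           - (c / 2) * (divpow (S k) x * cos x - divpow (S (S k)) x * sin x)) F1); auto.
         der_divpow; ring.
Qed.

Lemma span_primitive N a b w f :
  span N a b w f ->
  exists F, span (S N) (S a) b (w * (INR (a + b) + 2)) F /\ is_primitive f F.
Proof.
induction 1 as [w f Hw Hf | w v f g c k t Hf [F [HF PF]] Hk Hc Hw Hg].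
- exists (fun _ => 0); split.
  + apply span_nil; auto. pose proof (pos_INR (a + b)); nra.
  + split; auto. intros x; rewrite Hf; apply (is_derive_const (0 : R)).
- assert (HG : exists G, span (S N) (S a) b (Rabs c * (INR k + 2)) G /\
    is_primitive (fun x => c * mono k t x) G).
  { destruct t; [apply primitive_mono_one | apply primitive_mono_trig |
      apply primitive_mono_trig]; auto. }
  destruct HG as [G [HG PG]].
  exists (fun x => F x + G x); split.
  + eapply span_weaken; [| | | |apply span_plus; [exact HF|exact HG]]; auto.
    assert (INR k <= INR (a + b)) by (apply le_INR; destruct t; simpl in Hk; lia).
    pose proof (Rabs_pos c). pose proof (pos_INR k). nra.
  + apply (primitive_ext (fun x => f x + c * mono k t x) _ (fun x => F x + G x)); auto.
    now apply primitive_plus.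
Qed.

Lemma span_oscillator N a b w f :
  span N a b w f ->
  exists F, span (S (S N)) a (S b) (w * (INR (a + b) + 2)) F /\ is_oscillation f F.
Proof.
induction 1 as [w f Hw Hf | w v f g c k t Hf [F [HF PF]] Hk Hc Hw Hg].
- exists (fun _ => 0); split.
  + apply span_nil; auto. pose proof (pos_INR (a + b)); nra.
  + exists (fun _ => 0); split; [|split; [|split]]; auto; intros x; [|rewrite Hf, Rminus_0_r];
      apply (is_derive_const (0 : R)).
- assert (HG : exists G, span (S (S N)) a (S b) (Rabs c * (INR k + 2)) G /\
    is_oscillation (fun x => c * mono k t x) G).
  { destruct t; [now apply oscillator_mono_one | |];
      [destruct (oscillator_mono_trig N a b k c) as [[G [HG PG]] _]
      |destruct (oscillator_mono_trig N a b k c) as [_ [G [HG PG]]]]; auto;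
      exists G; split; auto; (eapply span_weaken; [| | | |exact HG]; auto;
        pose proof (Rabs_pos c); pose proof (pos_INR k); nra). }
  destruct HG as [G [HG PG]].
  exists (fun x => F x + G x); split.
  + eapply span_weaken; [| | | |apply span_plus; [exact HF|exact HG]]; auto.
    assert (INR k <= INR (a + b)) by (apply le_INR; destruct t; simpl in Hk; lia).
    pose proof (Rabs_pos c). pose proof (pos_INR k). nra.
  + apply (oscillator_ext (fun x => f x + c * mono k t x) _ (fun x => F x + G x)); auto.
    now apply oscillator_plus.
Qed.

(** * Size of the solutions on [[0, PI / 2]] *)

Lemma nondecreasing_from_0 (h h' : R -> R) (x : R) :
  0 <= x -> (forall t, 0 <= t <= x -> is_derive h t (h' t)) ->
  (forall t, 0 <= t <= x -> 0 <= h' t) -> h 0 <= h x.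
Proof.
intros Hx D P.
destruct (MVT_gen h 0 x h') as [c [Hc E]].
- intros t Ht; apply D; rewrite Rmin_left, Rmax_right in Ht; lra.
- intros t Ht; apply derivable_continuous_pt; exists (h' t); apply is_derive_Reals, D.
  rewrite Rmin_left, Rmax_right in Ht; lra.
- rewrite Rmin_left, Rmax_right in Hc by lra.
  pose proof (P c Hc). nra.
Qed.

Lemma primitive_le b f g F G :
  is_primitive f F -> is_primitive g G -> (forall x, 0 <= x <= b -> f x <= g x) ->
  forall x, 0 <= x <= b -> F x <= G x.
Proof.
intros [F0 HF] [G0 HG] H x Hx.
assert (G 0 - F 0 <= G x - F x); [|lra].
apply (nondecreasing_from_0 (fun t => G t - F t) (fun t => g t - f t)); try lra.
- intros t _; apply (is_derive_minus G F); auto.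
- intros t Ht; assert (f t <= g t) by (apply H; lra); lra.
Qed.

Lemma primitive_divpow c k :
  is_primitive (fun x => c * divpow k x) (fun x => c * divpow (S k) x).
Proof.
split; [rewrite divpow_S_at_0; ring|].
intros x; apply (is_derive_scal (divpow (S k))), is_derive_divpow_S.
Qed.

Lemma divpow_ge0 k x : 0 <= x -> 0 <= divpow k x.
Proof.
intros Hx; apply Rmult_le_pos; [now apply pow_le|].
apply Rlt_le, Rinv_0_lt_compat, INR_fact_lt_0.
Qed.

(** Half angles: on [[0, PI / 4]] the cosine is at least [c = cos (PI / 4)], hence
    [sin (u / 2) >= c * (u / 2)]; then [sin u = 2 sin (u / 2) cos (u / 2)] and [c * c = 1 / 2]. *)
Lemma sin_ge_half u : 0 <= u <= PI / 2 -> u / 2 <= sin u.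
Proof.
intros Hu.
assert (HP := PI_RGT_0).
set (c := cos (PI / 4)).
assert (Hc : 0 < c) by (apply cos_gt_0; lra).
assert (Hcc : c * c = / 2).
{ unfold c; rewrite cos_PI4. pose proof (sqrt_sqrt 2 ltac:(lra)).
  pose proof (sqrt_lt_R0 2 ltac:(lra)).
  apply (Rmult_eq_reg_r (sqrt 2 * sqrt 2)); [|nra].
  rewrite H at 2. field. lra. }
assert (Hcos : forall t, 0 <= t <= u / 2 -> c <= cos t).
{ intros t Ht; apply cos_decr_1; lra. }
assert (Hsin : c * (u / 2) <= sin (u / 2)).
{ assert (sin 0 - c * 0 <= sin (u / 2) - c * (u / 2)); [|rewrite sin_0 in *; lra].
  apply (nondecreasing_from_0 (fun t => sin t - c * t) (fun t => cos t - c)); try lra.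
  - intros t _; auto_derive; auto; ring.
  - intros t Ht; pose proof (Hcos t Ht); lra. }
pose proof (Hcos (u / 2) ltac:(lra)).
replace u with (2 * (u / 2)) at 2 by field.
rewrite sin_2a.
assert (c * (u / 2) * c <= sin (u / 2) * cos (u / 2)) by (apply Rmult_le_compat; nra).
nra.
Qed.

(* Variation of constants: [F x] is the integral of [f t * sin (x - t)]. *)
Lemma oscillator_lower c k f F :
  0 <= c -> is_oscillation f F ->
  (forall x, 0 <= x <= PI / 2 -> c * divpow k x <= f x) ->
  forall x, 0 <= x <= PI / 2 -> c / 2 * divpow (S (S k)) x <= F x.
Proof.
intros Hc (F1 & F0 & F10 & DF & DF1) H x Hx.
(* The first two terms have derivative [f t * sin (x - t)], the last one subtracts a primitive of
   [c / 2 * ((x - t) * divpow k t)]. At the ends, [phi 0 = 0] and [phi x] is the difference to be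
   shown nonnegative. *)
pose (phi t := F t * cos (x - t) + F1 t * sin (x - t)
  - c / 2 * ((x - t) * divpow (S k) t + divpow (S (S k)) t)).
assert (phi 0 <= phi x) as Hphi.
{ apply (nondecreasing_from_0 _
    (fun t => f t * sin (x - t) - c / 2 * ((x - t) * divpow k t))); try lra.
  - intros t _. unfold phi. auto_derive.
    + repeat match goal with
      | |- _ /\ _ => split
      | |- True => exact I
      | |- ex_derive (fun x => divpow _ x) _ => apply ex_derive_divpow
      end; eexists; [apply DF|apply DF1].
    + change (x + - t) with (x - t).
      replace (Derive (fun x => F x) t) with (F1 t)
        by (symmetry; apply is_derive_unique; auto).
      replace (Derive (fun x => F1 x) t) with (f t - F t)
        by (symmetry; apply is_derive_unique; auto).
      replace (Derive (fun x => divpow (S k) x) t) with (divpow k t)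
        by (symmetry; apply is_derive_unique, is_derive_divpow_S).
      replace (Derive (fun x => divpow (S (S k)) x) t) with (divpow (S k) t)
        by (symmetry; apply is_derive_unique, is_derive_divpow_S).
      field.
  - intros t Ht.
    assert (A := sin_ge_half (x - t) ltac:(lra)).
    assert (B := H t ltac:(lra)).
    assert (C := divpow_ge0 k t ltac:(lra)).
    assert (0 <= c * divpow k t) by nra.
    assert (c * divpow k t * ((x - t) / 2) <= f t * sin (x - t)).
    { apply Rmult_le_compat; lra. }
    lra. }
unfold phi in Hphi.
rewrite F0, F10, !divpow_S_at_0, Rminus_diag, cos_0, sin_0 in Hphi.
lra.
Qed.

(** Nonnegativity of [F] is [oscillator_lower] with constant 0; then [F'' = f - F <= f] can be
    integrated twice. *)
Lemma oscillator_upper k f F :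
  is_oscillation f F ->
  (forall x, 0 <= x <= PI / 2 -> 0 <= f x <= divpow k x) ->
  forall x, 0 <= x <= PI / 2 -> F x <= divpow (S (S k)) x.
Proof.
intros HO H.
assert (P : forall x, 0 <= x <= PI / 2 -> 0 <= F x).
{ intros x Hx.
  replace 0 with (0 / 2 * divpow (S (S 0)) x) by field.
  apply (oscillator_lower 0 0 f); auto; try lra.
  intros y Hy; rewrite Rmult_0_l; now apply H. }
destruct HO as (F1 & F0 & F10 & DF & DF1).
assert (Q : forall x, 0 <= x <= PI / 2 -> F1 x <= 1 * divpow (S k) x).
{ apply (primitive_le (PI / 2) (fun x => f x - F x) (fun x => 1 * divpow k x)).
  - now split.
  - apply primitive_divpow.
  - intros x Hx; pose proof (H x Hx); pose proof (P x Hx); lra. }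
intros x Hx.
rewrite <- (Rmult_1_l (divpow _ x)).
revert x Hx.
apply (primitive_le (PI / 2) F1 (fun x => 1 * divpow (S k) x)); auto.
- now split.
- apply primitive_divpow.
Qed.

(** One round is an oscillator step, which raises [b] and gains two powers of [x], and a primitive
    step, which raises [a] and gains one. Only the oscillator step loses a factor 2 in the lower
    bound. *)
Lemma small_trig_form n :
  exists f, span (3 * n) n n ((INR (2 * n) + 2) ^ (2 * n)) f /\
    forall x, 0 <= x <= PI / 2 ->
      (/ 2) ^ n * divpow (3 * n) x <= f x <= divpow (3 * n) x.
Proof.
induction n as [|n (f & Hf & Bf)].
- exists (fun x => 1 * mono 0 One x); split.
  + apply (span_weaken 0 0 0 (Rabs 1)); auto.
    * rewrite Rabs_R1; simpl; lra.
    * apply span_mono; auto. exists 1%Z; simpl; ring.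
  + intros x _; simpl. unfold mono; simpl. rewrite divpow_0; lra.
- destruct (span_oscillator _ _ _ _ _ Hf) as (g & Hg & Og).
  destruct (span_primitive _ _ _ _ _ Hg) as (h & Hh & Ph).
  assert (P3 : 0 < (/ 2) ^ n) by (apply pow_lt; lra).
  assert (Bg : forall x, 0 <= x <= PI / 2 ->
    (/ 2) ^ n / 2 * divpow (S (S (3 * n))) x <= g x <= divpow (S (S (3 * n))) x).
  { intros x Hx; split; revert x Hx.
    - apply (oscillator_lower _ _ f); auto; [lra|]. intros; now apply Bf.
    - apply (oscillator_upper _ f); auto. intros x Hx; split; [|now apply Bf].
      apply Rle_trans with (2 := proj1 (Bf x Hx)).
      pose proof (divpow_ge0 (3 * n) x (proj1 Hx)); nra. }
  exists h; split.
  + eapply span_weaken; [| | | |exact Hh]; try lia.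
    replace (n + n)%nat with (2 * n)%nat by lia.
    replace (n + S n)%nat with (S (2 * n))%nat by lia.
    replace (2 * S n)%nat with (S (S (2 * n)))%nat by lia.
    rewrite !S_INR. set (a := INR (2 * n)).
    assert (0 <= a) by apply pos_INR.
    assert ((a + 2) ^ (2 * n) <= (a + 1 + 1 + 2) ^ (2 * n)) by (apply pow_incr; lra).
    assert (0 <= (a + 2) ^ (2 * n)) by (apply pow_le; lra).
    rewrite <- !tech_pow_Rmult.
    set (u := (a + 1 + 1 + 2) ^ (2 * n)) in *. set (w := (a + 2) ^ (2 * n)) in *.
    assert (w * (a + 2) <= u * (a + 4)) by nra.
    assert (0 <= u * (a + 4)) by nra. nra.
  + replace (3 * S n)%nat with (S (S (S (3 * n)))) by lia.
    intros x Hx; split; revert x Hx.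
    * apply (primitive_le (PI / 2)
        (fun x => (/ 2) ^ S n * divpow (S (S (3 * n))) x) g); auto.
      -- apply primitive_divpow.
      -- intros x Hx; simpl pow. pose proof (Bg x Hx); lra.
    * intros x Hx; rewrite <- (Rmult_1_l (divpow _ x)); revert x Hx.
      apply (primitive_le (PI / 2) g (fun x => 1 * divpow (S (S (3 * n))) x)); auto.
      -- apply primitive_divpow.
      -- intros x Hx; pose proof (Bg x Hx); lra.
Qed.

(** * Evaluation at [PI / 2] and at rational points *)

Lemma divpow_le k x : 0 <= x <= 3 -> divpow k x <= 5.
Proof.
intros Hx; apply Rle_trans with (divpow k 3).
- unfold divpow, Rdiv; apply Rmult_le_compat_r.
  + apply Rlt_le, Rinv_0_lt_compat, INR_fact_lt_0.
  + now apply pow_incr.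
(* [3^k / k!] is nonincreasing from [k = 2] on, where it equals 9/2. *)
- destruct k as [|[|k]]; [unfold divpow; simpl; lra..|].
  induction k as [|k IH]; [unfold divpow; simpl; lra|].
  replace (divpow (S (S (S k))) 3) with (divpow (S (S k)) 3 * (3 / INR (S (S (S k))))).
  + assert (3 <= INR (S (S (S k)))) by (rewrite !S_INR; pose proof (pos_INR k); lra).
    assert (3 / INR (S (S (S k))) <= 1) by (apply Rle_div_l; lra).
    pose proof (divpow_ge0 (S (S k)) 3 ltac:(lra)).
    nra.
  + unfold divpow; rewrite (fact_simpl (S (S k))), mult_INR; simpl pow.
    field; split; [apply INR_fact_neq_0|apply not_0_INR; lia].
Qed.

Lemma divpow_lipschitz k x y :
  0 <= x <= 3 -> 0 <= y <= 3 -> Rabs (divpow k x - divpow k y) <= 5 * Rabs (x - y).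
Proof.
intros Hx Hy; destruct k as [|k].
- rewrite !divpow_0, Rminus_diag, Rabs_R0. pose proof (Rabs_pos (x - y)); lra.
- destruct (MVT_gen (divpow (S k)) y x (divpow k)) as [c [Hc E]].
  + intros t _; apply is_derive_divpow_S.
  + intros t _; apply derivable_continuous_pt; exists (divpow k t).
    apply is_derive_Reals, is_derive_divpow_S.
  + rewrite E, Rabs_mult. apply Rmult_le_compat_r; [apply Rabs_pos|].
    assert (Hc3 : 0 <= c <= 3).
    { unfold Rmin, Rmax in Hc; destruct (Rle_dec y x); lra. }
    rewrite Rabs_right; [now apply divpow_le|].
    apply Rle_ge, divpow_ge0; lra.
Qed.

(** [fact n] clears [fact k], [q^n] clears [q^k], and [c * 2^N] is an integer. *)
Lemma divpow_clear_denominators n N k c (p q : Z) :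
  (k <= n)%nat -> dyadic N k c -> q <> 0%Z ->
  exists z : Z,
    c * divpow k (IZR p / IZR q) * (INR (fact n) * 2 ^ N * IZR q ^ n) = IZR z.
Proof.
intros Hk [z Hz] Hq.
assert (Hd : exists m, fact n = (m * fact k)%nat).
{ clear Hz; induction n as [|n IH].
  - exists 1%nat. replace k with 0%nat by lia. reflexivity.
  - destruct (Nat.eq_dec k (S n)) as [->|Hne].
    + exists 1%nat; lia.
    + destruct IH as [m Hm]; [lia|]. exists (S n * m)%nat.
      rewrite fact_simpl, Hm; lia. }
destruct Hd as [m Hm].
exists (z * 2 ^ Z.of_nat k * Z.of_nat m * p ^ Z.of_nat k * q ^ Z.of_nat (n - k))%Z.
rewrite !mult_IZR, <- !pow_IZR, <- INR_IZR_INZ, <- Hz, Hm, mult_INR.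
replace (IZR q ^ n) with (IZR q ^ k * IZR q ^ (n - k))
  by (rewrite <- pow_add; f_equal; lia).
unfold divpow, Rdiv; rewrite Rpow_mult_distr, pow_inv.
field; split; [apply INR_fact_neq_0 | now apply pow_nonzero, not_0_IZR].
Qed.

(* At [PI / 2] the cosine terms vanish and the sine terms become polynomial. *)
Lemma span_at_half_PI N n w f :
  span N n n w f ->
  exists P : R -> R, f (PI / 2) = P (PI / 2) /\
    (forall x y, 0 <= x <= 3 -> 0 <= y <= 3 ->
      Rabs (P x - P y) <= 5 * w * Rabs (x - y)) /\
    (forall p q : Z, q <> 0%Z -> exists z : Z,
      P (IZR p / IZR q) * (INR (fact n) * 2 ^ N * IZR q ^ n) = IZR z).
Proof.
induction 1 as [w f Hw Hf | w v f g c k t Hf [P (E & L & I)] Hk Hc Hw Hg].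
- exists (fun _ => 0); split; [|split].
  + apply Hf.
  + intros x y _ _; rewrite Rminus_diag, Rabs_R0.
    pose proof (Rabs_pos (x - y)); nra.
  + intros p q _; exists 0%Z; ring.
- assert (Hw0 := span_weight_ge0 _ _ _ _ _ Hf).
  assert (Hcp := Rabs_pos c).
  destruct t.
  1,3: exists (fun x => P x + c * divpow k x); split; [|split];
    [ rewrite Hg, E; unfold mono; simpl trig_fun; rewrite ?sin_PI2; ring
    | intros x y Hx Hy;
      replace (_ - _) with (P x - P y + c * (divpow k x - divpow k y)) by ring;
      apply Rle_trans with (1 := Rabs_triang _ _);
      rewrite Rabs_mult;
      pose proof (L x y Hx Hy); pose proof (divpow_lipschitz k x y Hx Hy);
      pose proof (Rabs_pos (x - y));
      assert (Rabs c * Rabs (divpow k x - divpow k y) <= Rabs c * (5 * Rabs (x - y)))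
        by (apply Rmult_le_compat_l; auto); nra
    | intros p q Hq; destruct (I p q Hq) as [z1 Hz1];
      destruct (divpow_clear_denominators n N k c p q) as [z2 Hz2];
      [simpl in Hk; lia | auto | auto |];
      exists (z1 + z2)%Z; rewrite plus_IZR, <- Hz1, <- Hz2; ring ].
  exists P; split; [|split]; auto.
  + rewrite Hg, E; unfold mono; simpl trig_fun; rewrite cos_PI2; ring.
  + intros x y Hx Hy; apply Rle_trans with (1 := L x y Hx Hy).
    pose proof (Rabs_pos (x - y)); nra.
Qed.

(** * Rational approximations of PI *)

Lemma fact_add_ge n m : INR (fact n) * INR n ^ m <= INR (fact (n + m)).
Proof.
induction m as [|m IH]; [rewrite Nat.add_0_r; simpl; lra|].
replace (n + S m)%nat with (S (n + m)) by lia.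
rewrite fact_simpl, mult_INR; simpl pow.
assert (INR n <= INR (S (n + m))) by (apply le_INR; lia).
pose proof (pos_INR n). pose proof (INR_fact_lt_0 n).
pose proof (pow_le (INR n) m (pos_INR n)).
replace (INR (fact n) * (INR n * INR n ^ m))
  with (INR n * (INR (fact n) * INR n ^ m)) by ring.
apply Rmult_le_compat; nra.
Qed.

Lemma fact_le_pow n : INR (fact n) <= INR n ^ n.
Proof.
cut (forall m, (m <= n)%nat -> INR (fact m) <= INR n ^ m); [auto|].
induction m as [|m IH]; intros Hm; [simpl; lra|].
rewrite fact_simpl, mult_INR; simpl pow.
apply Rmult_le_compat; auto using pos_INR, le_INR.
apply IH; lia.
Qed.

Lemma ln_cube_le x : 1 <= x -> ln x ^ 3 <= 6 * x.
Proof.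
intros Hx.
assert (0 <= ln x) by (rewrite <- ln_1; destruct Hx as [Hx|<-]; [left; apply ln_increasing|]; lra).
pose proof (exp_ge_taylor (ln x) 3 H) as T.
rewrite exp_ln in T by lra. simpl in T.
assert (0 <= ln x * ln x) by nra.
simpl. lra.
Qed.

(** With [M = n! 2^(3n) q^n], the number [P (p / q) * M] is an integer, while [P (PI / 2) * M] lies
    strictly between 0 and 1. So the two values of [P] differ, and the Lipschitz bound converts this
    into a distance between the arguments. *)
Lemma half_PI_approx_lower (n p q : nat) :
  (12 <= n)%nat -> (0 < q)%nat -> (128 * q <= n * n)%nat -> INR p / INR q <= 3 ->
  1 <= (3 * INR n) ^ (6 * n) * Rabs (INR p / INR q - PI / 2).
Proof.
intros Hn Hq Hqn Hpq.
destruct (small_trig_form n) as (f & Hf & Bf).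
destruct (span_at_half_PI _ _ _ _ Hf) as (P & E & L & I).
assert (HP0 := PI_RGT_0). assert (HP4 := PI_4). assert (HP2 := PI2_3_2).
specialize (Bf (PI / 2) ltac:(lra)). rewrite E in Bf.
assert (HN : 12 <= INR n) by (replace 12 with (INR 12) by (simpl; lra); now apply le_INR).
assert (HQ : 1 <= INR q) by (change 1 with (INR 1); now apply le_INR).
assert (HQN : 128 * INR q <= INR n * INR n).
{ apply le_INR in Hqn. rewrite !mult_INR in Hqn.
  replace (INR 128) with 128 in Hqn by (simpl; lra). auto. }
assert (Hpq0 : 0 <= INR p / INR q).
{ apply Rmult_le_pos; [apply pos_INR|]. apply Rlt_le, Rinv_0_lt_compat; lra. }
specialize (L (INR p / INR q) (PI / 2) ltac:(lra) ltac:(lra)).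
destruct (I (Z.of_nat p) (Z.of_nat q)) as [z Hz]; [lia|].
rewrite <- !INR_IZR_INZ in Hz.
set (x := INR p / INR q) in *. set (d := Rabs (x - PI / 2)) in *.
set (w := (INR (2 * n) + 2) ^ (2 * n)) in *.
set (M := INR (fact n) * 2 ^ (3 * n) * INR q ^ n) in *.
set (N := 3 * INR n).
assert (Hw : 0 < w <= N ^ (2 * n)).
{ unfold w, N; rewrite mult_INR; simpl (INR 2); split.
  - apply pow_lt; lra.
  - apply pow_incr; lra. }
assert (Hd : 0 <= d) by apply Rabs_pos.
assert (Hdiff : P (PI / 2) - P x <= 5 * w * d).
{ apply Rle_trans with (2 := L). rewrite Rabs_minus_sym. apply Rle_abs. }
assert (HNn : forall k, 0 < N ^ k) by (intros; apply pow_lt; unfold N; lra).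
assert (HF : 0 < INR (fact (3 * n))) by apply INR_fact_lt_0.
assert (HFN : INR (fact (3 * n)) <= N ^ (3 * n)).
{ unfold N. replace (3 * INR n) with (INR (3 * n)) by (rewrite mult_INR; simpl; lra).
  apply fact_le_pow. }
assert (H6 : N ^ (6 * n) = N ^ (2 * n) * N ^ (3 * n) * N ^ n).
{ rewrite <- !pow_add; f_equal; lia. }
(* A spare factor [N ^ n] absorbs the constants, since [N >= 36 = 18 * 2] and [18 ^ n >= 20]. *)
assert (H36 : 20 * 2 ^ n <= N ^ n).
{ apply Rle_trans with (18 ^ n * 2 ^ n).
  - apply Rmult_le_compat_r; [apply pow_le; lra|].
    apply Rle_trans with (18 ^ 2); [lra|]. apply Rle_pow; [lra|lia].
  - rewrite <- Rpow_mult_distr. apply pow_incr; unfold N; lra. }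
assert (H2n : 1 <= 2 ^ n) by (apply pow_R1_Rle; lra).
assert (HM : 0 < M).
{ unfold M; repeat apply Rmult_lt_0_compat;
    [apply INR_fact_lt_0 | apply pow_lt; lra | apply pow_lt; lra]. }
(* If [z <= 0], the values differ by at least [P (PI / 2)], bounded below by [small_trig_form]; if
   [z >= 1], they differ by at least [1 / (2 * M)]. *)
destruct (Z_le_gt_dec z 0) as [Hz0|Hz1].
- assert (Px : P x <= 0).
  { apply IZR_le in Hz0. rewrite <- Hz in Hz0. nra. }
  assert (V : (/ 2) ^ n * / INR (fact (3 * n)) <= P (PI / 2)).
  { apply Rle_trans with (2 := proj1 Bf). apply Rmult_le_compat_l; [apply pow_le; lra|].
    unfold divpow. rewrite <- (Rmult_1_l (/ _)) at 1. apply Rmult_le_compat_r.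
    - now apply Rlt_le, Rinv_0_lt_compat.
    - apply pow_R1_Rle; lra. }
  assert (V' : 1 <= (5 * w * d) * (2 ^ n * INR (fact (3 * n)))).
  { replace 1 with ((/ 2) ^ n * / INR (fact (3 * n)) * (2 ^ n * INR (fact (3 * n)))).
    - apply Rmult_le_compat_r; [|lra]. nra.
    - rewrite pow_inv. field. split; [lra|]. lra. }
  apply Rle_trans with (1 := V').
  replace (5 * w * d * (2 ^ n * INR (fact (3 * n))))
    with ((w * INR (fact (3 * n)) * (5 * 2 ^ n)) * d) by ring.
  rewrite H6. apply Rmult_le_compat_r; auto.
  apply Rmult_le_compat; try lra.
  + apply Rmult_le_pos; lra.
  + apply Rmult_le_compat; lra.
- assert (Px : 1 <= P x * M).
  { rewrite Hz. apply IZR_le. lia. }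
  assert (VM : P (PI / 2) * M <= / 2).
  { apply Rle_trans with (2 ^ (3 * n) / INR (fact (3 * n)) * M).
    - apply Rmult_le_compat_r; [lra|]. apply Rle_trans with (1 := proj2 Bf).
      unfold divpow, Rdiv. apply Rmult_le_compat_r;
        [now apply Rlt_le, Rinv_0_lt_compat | apply pow_incr; lra].
    - assert (Hfact := fact_add_ge n (2 * n)).
      replace (n + 2 * n)%nat with (3 * n)%nat in Hfact by lia.
      apply Rmult_le_reg_r with (INR (fact (3 * n))); [lra|].
      replace (2 ^ (3 * n) / INR (fact (3 * n)) * M * INR (fact (3 * n)))
        with (2 ^ (3 * n) * M) by (field; lra).
      apply Rle_trans with (/ 2 * (INR (fact n) * INR n ^ (2 * n))); [|lra].
      unfold M.
      replace (2 ^ (3 * n) * (INR (fact n) * 2 ^ (3 * n) * INR q ^ n))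
        with (INR (fact n) * (2 ^ (3 * n) * 2 ^ (3 * n) * INR q ^ n)) by ring.
      replace (/ 2 * (INR (fact n) * INR n ^ (2 * n)))
        with (INR (fact n) * (/ 2 * INR n ^ (2 * n))) by ring.
      apply Rmult_le_compat_l; [apply Rlt_le, INR_fact_lt_0|].
      (* Here [128 * q <= n * n] enters: [(64 q)^n = (128 q)^n / 2^n <= n^(2n) / 2]. *)
      rewrite !pow_mult, <- !Rpow_mult_distr.
      apply Rle_trans with (/ 2 ^ n * (128 * INR q) ^ n).
      + rewrite <- pow_inv, <- Rpow_mult_distr. right; f_equal. simpl. field.
      + apply Rmult_le_compat.
        * apply Rlt_le, Rinv_0_lt_compat; lra.
        * apply pow_le; lra.
        * apply Rinv_le_contravar; [lra|].
          rewrite <- (pow_1 2) at 1. apply Rle_pow; [lra|lia].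
        * apply pow_incr; simpl; lra. }
  assert (V : / 2 <= 5 * w * d * M).
  { assert (P x - P (PI / 2) <= 5 * w * d).
    { apply Rle_trans with (2 := L). apply Rle_abs. }
    nra. }
  assert (HM' : M * 10 <= N ^ (3 * n) * N ^ n).
  { assert (A : INR (fact n) * 2 ^ (3 * n) * INR q ^ n <= N ^ (3 * n)).
    { apply Rle_trans with (INR n ^ n * 8 ^ n * (INR n * INR n) ^ n).
      - rewrite pow_mult. replace (2 ^ 3) with 8 by (simpl; lra).
        apply Rmult_le_compat.
        + apply Rmult_le_pos; [apply pos_INR | apply pow_le; lra].
        + apply pow_le; lra.
        + apply Rmult_le_compat_r; [apply pow_le; lra | apply fact_le_pow].
        + apply pow_incr; lra.
      - rewrite <- !Rpow_mult_distr, (pow_mult N). apply pow_incr. unfold N; simpl.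
        assert (0 <= INR n * INR n * INR n) by (repeat apply Rmult_le_pos; lra).
        split; nra. }
    fold M in A. apply Rmult_le_compat; lra. }
  rewrite H6.
  assert (w * (M * 10) <= N ^ (2 * n) * (N ^ (3 * n) * N ^ n))
    by (apply Rmult_le_compat; nra).
  apply Rle_trans with (w * (M * 10) * d); [lra|].
  apply Rmult_le_compat_r; auto. now rewrite Rmult_assoc.
Qed.

(* Niven's integral, which uses a single differential operator [D ^ 2 + 1], would only give
   [y <= K * h * ln h], and [sum 1 / (n g n)] diverges for the resulting gaps
   [g n], of order [ln n / ln (ln n)]. *)
Lemma two_PI_multiple_approx :
  exists K : R, 0 < K /\ forall (h k : nat) (y : R),
    (0 < h)%nat -> (0 < k)%nat -> 0 <= y ->
    Rabs (INR h - 2 * PI * INR k) <= exp (- y) -> y ^ 3 <= K * INR h ^ 2.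
Proof.
(* The factor [3888 = 6^3 * 18] comes from [(6 n ln (3 n))^3] and [ln_cube_le], [576] from
   [n^2 <= 576 q], and [2] from [(4 k)^2 <= 2 h^2], as [3 k <= h]. *)
exists (2 * (3888 * (576 * 576))); split; [lra|].
intros h k y Hh Hk Hy Hd.
assert (HP0 := PI_RGT_0). assert (HP4 := PI_4). assert (HP2 := PI2_3_2).
assert (Hh1 : 1 <= INR h) by (change 1 with (INR 1); now apply le_INR).
assert (Hk1 : 1 <= INR k) by (change 1 with (INR 1); now apply le_INR).
assert (He : exp (- y) <= 1).
{ rewrite <- exp_0. destruct Hy as [Hy|<-]; [left; apply exp_increasing; lra|].
  right; f_equal; ring. }
(* For [q = 4 k], [h / q - PI / 2] is the given error divided by [q]. As [m] is just above the root
   of [q], [n = 12 m] satisfies [128 q <= n^2] while staying of order [sqrt q]. *)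
pose (q := (4 * k)%nat). pose (m := S (Nat.sqrt q)). pose (n := (12 * m)%nat).
assert (Hq : INR q = 4 * INR k) by (unfold q; rewrite mult_INR; simpl; lra).
destruct (Nat.sqrt_spec q ltac:(lia)) as [S1 S2].
assert (Hs : (1 <= Nat.sqrt q)%nat).
{ destruct (Nat.sqrt q) as [|r]; [|lia]. unfold q in S2; lia. }
assert (Hm : (q <= m * m <= 4 * q)%nat) by (unfold m; nia).
assert (Hx : INR h / INR q - PI / 2 = (INR h - 2 * PI * INR k) / INR q).
{ rewrite Hq; field; lra. }
assert (Hxle : Rabs (INR h / INR q - PI / 2) <= exp (- y)).
{ rewrite Hx. unfold Rdiv. rewrite Rabs_mult, (Rabs_right (/ _)).
  - apply Rle_trans with (2 := Hd). rewrite <- (Rmult_1_r (Rabs _)) at 2.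
    apply Rmult_le_compat_l; [apply Rabs_pos|].
    rewrite <- Rinv_1. apply Rinv_le_contravar; lra.
  - apply Rle_ge, Rlt_le, Rinv_0_lt_compat; lra. }
assert (Hd1 : Rabs (INR h - 2 * PI * INR k) <= 1) by lra.
apply Rabs_le_between in Hd1.
assert (Happrox : 1 <= (3 * INR n) ^ (6 * n) * Rabs (INR h / INR q - PI / 2)).
{ apply half_PI_approx_lower.
  - unfold n; lia.
  - unfold q; lia.
  - unfold n; nia.
  - apply Rle_div_l; [lra|]. nra. }
assert (HN : 36 <= 3 * INR n).
{ unfold n. rewrite mult_INR. replace (INR 12) with 12 by (simpl; lra).
  assert (1 <= INR m) by (change 1 with (INR 1); apply le_INR; lia). lra. }
assert (Hpow : 0 < (3 * INR n) ^ (6 * n)) by (apply pow_lt; lra).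
assert (Hln0 : 0 <= ln (3 * INR n)).
{ rewrite <- ln_1; left; apply ln_increasing; lra. }
assert (Hyn : y <= INR (6 * n) * ln (3 * INR n)).
{ rewrite <- ln_pow by lra. rewrite <- (ln_exp y).
  apply Rcomplements.ln_le; [apply exp_pos|].
  apply Rmult_le_reg_r with (exp (- y)); [apply exp_pos|].
  rewrite <- exp_plus, Rplus_opp_r, exp_0.
  apply Rle_trans with (1 := Happrox). apply Rmult_le_compat_l; lra. }
assert (Hln := ln_cube_le (3 * INR n) ltac:(lra)).
rewrite mult_INR in Hyn. replace (INR 6) with 6 in Hyn by (simpl; lra).
assert (Hy3 : y ^ 3 <= 3888 * (INR n * INR n) ^ 2).
{ apply Rle_trans with ((6 * INR n * ln (3 * INR n)) ^ 3).
  - now apply pow_incr.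
  - rewrite Rpow_mult_distr.
    apply Rle_trans with ((6 * INR n) ^ 3 * (6 * (3 * INR n))).
    + apply Rmult_le_compat_l; auto. apply pow_le; lra.
    + right; ring. }
assert (Hnn : INR n * INR n <= 576 * INR q).
{ rewrite <- mult_INR. replace 576 with (INR 576) by (rewrite INR_IZR_INZ; reflexivity).
  rewrite <- mult_INR. apply le_INR. unfold n; nia. }
assert (Hkh : 3 * INR k <= INR h) by nra.
apply Rle_trans with (1 := Hy3).
apply Rle_trans with (3888 * (576 * INR q) ^ 2).
- apply Rmult_le_compat_l; [lra|]. apply pow_incr; split; [apply Rle_0_sqr|auto].
- rewrite Hq. simpl. nra.
Qed.

(** * Resonant indices *)

(* Equivalently, [n] is within about [n ^ (- 1 / 4)] of [PI / 2] modulo [2 * PI]. *)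
Definition resonant (n : nat) : Prop := 1 - sin (INR n) < / sqrt (INR n).

Lemma resonant_dec n : {resonant n} + {~ resonant n}.
Proof. apply Rlt_dec. Qed.

(** Right side minus left side is half of [(2 - sin a - sin b)^2 + (cos a + cos b)^2].
    Geometrically, the chord between two points of the circle is compared with their chords to the
    point at angle [PI / 2]. *)
Lemma one_minus_cos_sub_le a b :
  1 - cos (b - a) <= 2 * (1 - sin a) + 2 * (1 - sin b).
Proof.
rewrite cos_minus.
pose proof (sin2_cos2 a) as Ha; pose proof (sin2_cos2 b) as Hb; unfold Rsqr in *.
pose proof (Rle_0_sqr (2 - sin a - sin b)); pose proof (Rle_0_sqr (cos a + cos b)).
unfold Rsqr in *. nra.
Qed.

Lemma two_PI_nearest x : 0 < x -> exists k : nat, Rabs (x - 2 * PI * INR k) <= PI.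
Proof.
intros Hx.
assert (HP := PI_RGT_0).
set (r := x / (2 * PI) + / 2).
assert (Er : x = (r - / 2) * (2 * PI)) by (unfold r; field; lra).
assert (Hr : / 2 < r).
{ assert (0 < x / (2 * PI)) by (apply Rdiv_lt_0_compat; lra). unfold r; lra. }
destruct (nfloor_ex r) as [k Hk]; [lra|].
exists k. apply Rabs_le_between. rewrite Er. nra.
Qed.

(** Use [1 - cos d = 2 sin (d / 2)^2] and [sin_ge_half] at [Rabs d / 2]. *)
Lemma one_minus_cos_ge d : Rabs d <= PI -> d * d / 8 <= 1 - cos d.
Proof.
intros Hd.
assert (E : forall t, 1 - cos t = 2 * (sin (t / 2) * sin (t / 2))).
{ intros t. replace t with (2 * (t / 2)) at 1 by field. rewrite cos_2a_sin. ring. }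
replace (cos d) with (cos (Rabs d))
  by (unfold Rabs; destruct (Rcase_abs d); [apply cos_neg | reflexivity]).
replace (d * d) with (Rabs d * Rabs d)
  by (rewrite <- Rabs_mult; apply Rabs_right, Rle_ge, Rle_0_sqr).
rewrite E.
pose proof (Rabs_pos d).
pose proof (sin_ge_half (Rabs d / 2) ltac:(lra)).
nra.
Qed.

(* Differences of resonant indices are close to multiples of [2 * PI].  The constant
   [1048576 = 32 ^ 4] makes the error at most [m ^ (- 1 / 8)]. *)
Lemma resonant_gap :
  exists c : R, 0 < c /\ forall m n : nat,
    1048576 <= INR m -> (m < n)%nat -> resonant m -> resonant n ->
    c * ln (INR m) ^ 3 <= INR (n - m) ^ 2.
Proof.
destruct two_PI_multiple_approx as (K & HK & HP).
exists (/ (512 * K)); split; [apply Rinv_0_lt_compat; lra|].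
intros m n Hm Hmn Rm Rn.
set (h := (n - m)%nat).
assert (Hh : 1 <= INR h) by (change 1 with (INR 1); apply le_INR; unfold h; lia).
assert (Eh : INR h = INR n - INR m) by (apply minus_INR; lia).
(* The fourth root of [m], at least 32. It leads to [d * d <= 32 / r^2 <= 1 / r], hence to
   [Rabs d <= m^(-1/8) = exp (- y)]. *)
set (r := sqrt (sqrt (INR m))).
assert (Hr0 : sqrt (INR m) = r * r) by (symmetry; apply sqrt_sqrt, sqrt_pos).
assert (Hr1 : INR m = (r * r) * (r * r)) by (rewrite <- Hr0; symmetry; apply sqrt_sqrt; lra).
assert (Hrp : 0 <= r) by apply sqrt_pos.
assert (Hr : 32 <= r).
{ apply Rnot_lt_le; intros Hlt.
  assert (r * r < 1024) by nra. assert (0 <= r * r) by nra. nra. }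
assert (Hcos : 1 - cos (INR h) <= 4 * / (r * r)).
{ rewrite Eh. apply Rle_trans with (1 := one_minus_cos_sub_le _ _).
  unfold resonant in Rm, Rn. rewrite <- Hr0.
  assert (/ sqrt (INR n) <= / sqrt (INR m)); [|lra].
  apply Rinv_le_contravar; [rewrite Hr0; nra|].
  apply sqrt_le_1_alt, le_INR; lia. }
destruct (two_PI_nearest (INR h) ltac:(lra)) as [k Hk].
set (d := INR h - 2 * PI * INR k) in *.
assert (Hd : d * d <= 32 * / (r * r)).
{ assert (cos (INR h) = cos d).
  { rewrite <- (cos_period d k). f_equal. unfold d; ring. }
  pose proof (one_minus_cos_ge d Hk). lra. }
assert (Hrr : / (r * r) <= / (32 * r)) by (apply Rinv_le_contravar; nra).
assert (Hd' : d * d <= / r).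
{ replace (/ r) with (32 * / (32 * r)) by (field; lra). lra. }
assert (Hri : / r <= / 32) by (apply Rinv_le_contravar; lra).
(* [k = 0] would make [d = h >= 1], against [d * d <= 1 / 32]. *)
assert (Hk1 : (0 < k)%nat).
{ destruct k; [|lia]. exfalso. unfold d in Hd'. simpl in Hd'. nra. }
set (y := ln (INR m) / 8).
assert (Hln : ln (INR m) = 4 * ln r).
{ rewrite Hr1. rewrite !ln_mult by nra. ring. }
assert (Hlnr : 0 < ln r) by (rewrite <- ln_1; apply ln_increasing; lra).
assert (Hy : Rabs d <= exp (- y)).
{ apply Rsqr_incr_0; [|apply Rabs_pos|apply Rlt_le, exp_pos].
  rewrite <- Rsqr_abs. unfold Rsqr. rewrite <- exp_plus.
  replace (- y + - y) with (- ln r) by (unfold y; rewrite Hln; field).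
  rewrite exp_Ropp, exp_ln by lra. auto. }
assert (H3 := HP h k y ltac:(lia) Hk1 ltac:(unfold y; lra) Hy).
apply Rmult_le_reg_l with (512 * K); [lra|].
rewrite <- Rmult_assoc, Rinv_r, Rmult_1_l by lra.
replace (ln (INR m) ^ 3) with (512 * y ^ 3) by (unfold y; field).
lra.
Qed.

(** * Summation over sparse indices *)

Lemma ln_1p_ge_half t : 0 <= t <= 1 -> t / 2 <= ln (1 + t).
Proof.
intros Ht. rewrite <- (ln_exp (t / 2)).
apply Rcomplements.ln_le; [apply exp_pos|].
apply Rmult_le_reg_r with (exp (- (t / 2))); [apply exp_pos|].
rewrite <- exp_plus, Rplus_opp_r, exp_0.
(* It remains that [1 <= (1 + t) * (1 - t / 2)] on [[0, 1]]. *)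
pose proof (exp_ineq1_le (- (t / 2))).
nra.
Qed.

(* A discrete form of [(1 / sqrt (ln x))' = - 1 / (2 x (ln x)^(3/2))]. *)
Lemma inv_sqrt_ln_drop c x h :
  0 < c <= / 6 -> 3 <= x -> 0 <= h -> c * ln x ^ 3 <= h ^ 2 ->
  sqrt c / 12 * / x <= / sqrt (ln x) - / sqrt (ln (x + h)).
Proof.
intros Hc Hx Hh Hch.
assert (HL : 1 <= ln x).
{ rewrite <- (ln_exp 1). apply Rcomplements.ln_le; [apply exp_pos|].
  pose proof exp_le_3; lra. }
(* Capping the gap at [x] keeps [t = h1 / x] in [[0, 1]]; the gap hypothesis survives because
   [c * ln x ^ 3 <= x <= x ^ 2]. *)
set (h1 := Rmin h x).
assert (Hh1 : 0 <= h1 <= x) by (unfold h1, Rmin; destruct (Rle_dec h x); lra).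
assert (Hch1 : c * ln x ^ 3 <= h1 ^ 2).
{ unfold h1, Rmin; destruct (Rle_dec h x); auto.
  pose proof (ln_cube_le x ltac:(lra)).
  assert (0 <= ln x ^ 3) by (apply pow_le; lra).
  assert (c * ln x ^ 3 <= / 6 * ln x ^ 3) by (apply Rmult_le_compat_r; lra).
  simpl in *; nra. }
set (L := ln x) in *. set (a := sqrt L).
assert (Haa : a * a = L) by (apply sqrt_sqrt; lra).
assert (Ha : 1 <= a) by (rewrite <- sqrt_1; now apply sqrt_le_1_alt).
assert (Hsc : 0 < sqrt c) by (apply sqrt_lt_R0; lra).
assert (Hscc : sqrt c * sqrt c = c) by (apply sqrt_sqrt; lra).
assert (Hh1' : sqrt c * (L * a) <= h1).
{ apply Rsqr_incr_0_var; [|lra]. unfold Rsqr.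
  replace (sqrt c * (L * a) * (sqrt c * (L * a)))
    with (sqrt c * sqrt c * (L * L * (a * a))) by ring.
  rewrite Haa, Hscc. simpl in Hch1. lra. }
set (t := h1 / x).
assert (Ht : 0 <= t <= 1).
{ split; [apply Rmult_le_pos; [lra|apply Rlt_le, Rinv_0_lt_compat; lra]|].
  apply Rle_div_l; lra. }
set (L' := L + t / 2).
assert (HL' : L' <= ln (x + h)).
{ apply Rle_trans with (L + ln (1 + t)).
  - pose proof (ln_1p_ge_half t Ht). unfold L'; lra.
  - unfold L. rewrite <- ln_mult by lra. apply Rcomplements.ln_le; [nra|].
    replace (x * (1 + t)) with (x + h1) by (unfold t; field; lra).
    pose proof (Rmin_l h x). unfold h1; lra. }
set (b := sqrt L').
assert (Hbb : b * b = L') by (apply sqrt_sqrt; unfold L'; lra).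
assert (Hab : a <= b) by (apply sqrt_le_1_alt; unfold L'; lra).
assert (Hb2 : b <= 2 * a).
{ apply Rsqr_incr_0_var; [|lra]. unfold Rsqr. rewrite Hbb. unfold L'. nra. }
apply Rle_trans with (/ a - / b).
2:{ assert (/ sqrt (ln (x + h)) <= / b); [|lra].
    apply Rinv_le_contravar; [lra|]. now apply sqrt_le_1_alt. }
(* Difference of reciprocals with [b^2 - a^2 = t / 2]; since [b <= 2 a], the denominator is at most
   [6 a^3]. *)
replace (/ a - / b) with (t / 2 * / (a * b * (a + b))).
2:{ replace (t / 2) with (b * b - a * a) by (rewrite Hbb, Haa; unfold L'; ring).
    field; repeat split; nra. }
assert (Hden : a * b * (a + b) <= 6 * (L * a)).
{ rewrite <- Haa. assert (a * b <= 2 * (a * a)) by nra.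
  assert (a * b * (a + b) <= 2 * (a * a) * (3 * a)) by (apply Rmult_le_compat; nra).
  lra. }
apply Rle_trans with (t / 2 * / (6 * (L * a))).
- unfold t. apply Rmult_le_reg_r with (12 * x * (L * a)).
  + repeat apply Rmult_lt_0_compat; lra.
  + replace (sqrt c / 12 * / x * (12 * x * (L * a))) with (sqrt c * (L * a))
      by (field; lra).
    replace (h1 / x / 2 * / (6 * (L * a)) * (12 * x * (L * a))) with h1
      by (field; lra).
    auto.
- apply Rmult_le_compat_l; [lra|]. apply Rinv_le_contravar; [|auto].
  repeat apply Rmult_lt_0_compat; lra.
Qed.

Definition selected (B : nat -> Prop) (B_dec : forall n, {B n} + {~ B n}) (u : nat -> R)
  (n : nat) : R := if B_dec n then u n else 0.

(* Each selected term but the first is paid for by the decrease of [Phi] since the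
   previous selected index. *)
Lemma sparse_sum_bounded (B : nat -> Prop) (B_dec : forall n, {B n} + {~ B n})
  (u Phi : nat -> R) (M A : R) (N0 : nat) :
  (forall n, 0 <= u n <= M) -> (forall n, (N0 <= n)%nat -> 0 <= Phi n <= A) ->
  (forall m n, (N0 <= m)%nat -> (m < n)%nat -> B m -> B n -> u n <= Phi m - Phi n) ->
  exists C, forall N, sum_n (selected B B_dec u) N <= C.
Proof.
intros Hu HPhi Hgap.
set (S0 := sum_n (selected B B_dec u) N0).
assert (HM : 0 <= M) by (pose proof (Hu 0%nat); lra).
assert (HA : 0 <= A) by (pose proof (HPhi N0 (le_n _)); lra).
assert (Hsel : forall n, 0 <= selected B B_dec u n)
  by (intros n; unfold selected; destruct (B_dec n); [apply Hu|lra]).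
exists (S0 + M + A); intros N.
destruct (Nat.le_gt_cases N0 N) as [HN|HN].
(* Invariant: either nothing has been added beyond [S0], or the sum plus [Phi] at some selected [n]
   is bounded. The first selected term costs at most [M], and its [Phi] at most [A]. *)
- enough (sum_n (selected B B_dec u) N <= S0 \/ exists n, (N0 <= n <= N)%nat /\ B n /\
    sum_n (selected B B_dec u) N + Phi n <= S0 + M + A) as [H|(n & Hn & _ & H)];
    [lra | pose proof (HPhi n ltac:(lia)); lra |].
  induction HN as [|N HN IH]; [left; apply Rle_refl|].
  rewrite sum_Sn; unfold plus; simpl.
  unfold selected at 2 4. destruct (B_dec (S N)) as [HB|HB].
  + right. exists (S N). split; [lia|]. split; auto.
    destruct IH as [H|(n & Hn & Bn & H)].
    * pose proof (proj2 (Hu (S N))). pose proof (HPhi (S N) ltac:(lia)). lra.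
    * pose proof (Hgap n (S N) ltac:(lia) ltac:(lia) Bn HB). lra.
  + rewrite Rplus_0_r. destruct IH as [H|(n & Hn & H)]; [now left|].
    right; exists n; split; [lia|auto].
- assert (sum_n (selected B B_dec u) N <= S0); [|lra]. unfold S0.
  clear - Hsel HN. induction HN as [|K HK IH].
  + rewrite sum_Sn; unfold plus; simpl. pose proof (Hsel (S N)); lra.
  + rewrite sum_Sn; unfold plus; simpl. pose proof (Hsel (S K)); lra.
Qed.

(** * Comparison series and conclusion *)

Lemma ex_series_bounded (a : nat -> R) (C : R) :
  (forall n, 0 <= a n) -> (forall N, sum_n a N <= C) -> ex_series a.
Proof.
intros Ha HC.
destruct (ex_finite_lim_seq_incr (sum_n a) C) as [l Hl]; auto.
- intros n; rewrite sum_Sn; unfold plus; simpl. pose proof (Ha (S n)); lra.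
- now exists l.
Qed.

Lemma ex_series_inv_sqr (c : R) :
  0 <= c -> ex_series (fun k => c / INR (S k) ^ 2).
Proof.
intros Hc.
apply (ex_series_scal_l c (fun k => / INR (S k) ^ 2)).
apply (ex_series_bounded _ 2).
- intros n. apply Rlt_le, Rinv_0_lt_compat, pow_lt, lt_0_INR; lia.
(* Telescoping with [1 / (x + 1)^2 <= 1 / x - 1 / (x + 1)]. *)
- intros N. apply Rle_trans with (2 - / INR (S N)).
  + induction N as [|N IH].
    * rewrite sum_O; simpl; lra.
    * rewrite sum_Sn; unfold plus; simpl Hierarchy.plus.
      assert (/ INR (S (S N)) ^ 2 <= / INR (S N) - / INR (S (S N))).
      { rewrite (S_INR (S N)). set (x := INR (S N)).
        assert (0 < x) by (apply lt_0_INR; lia).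
        replace (/ x - / (x + 1)) with (/ (x * (x + 1))) by (field; lra).
        apply Rinv_le_contravar; [|simpl]; nra. }
      simpl in *; lra.
  + assert (0 < / INR (S N)) by (apply Rinv_0_lt_compat, lt_0_INR; lia). lra.
Qed.

(** The base is at most [1 - 1 / (3 sqrt n) <= exp (- 1 / (3 sqrt n))], so the power is at most
    [exp (- sqrt n / 3)]; then [exp t >= t^2 / 2] at [t = sqrt n / 3]. *)
Lemma nonresonant_term (n : nat) :
  (0 < n)%nat -> ~ resonant n ->
  (2 / 3 + 1 / 3 * sin (INR n)) ^ n <= 18 / INR n.
Proof.
intros Hn Rn.
assert (HN : 0 < INR n) by now apply lt_0_INR.
apply Rnot_lt_le in Rn.
set (r := sqrt (INR n)) in *.
assert (Hr : 0 < r) by now apply sqrt_lt_R0.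
assert (Hrr : r * r = INR n) by (apply sqrt_sqrt; lra).
pose proof (SIN_bound (INR n)) as Hs.
apply Rle_trans with (exp (- (/ r / 3)) ^ n).
- apply pow_incr; split; [lra|].
  apply Rle_trans with (1 + - (/ r / 3)); [lra|apply exp_ineq1_le].
- rewrite <- Rpower_pow by apply exp_pos. unfold Rpower. rewrite ln_exp.
  replace (INR n * - (/ r / 3)) with (- (r / 3)) by (rewrite <- Hrr; field; lra).
  rewrite exp_Ropp.
  replace (18 / INR n) with (/ (INR n / 18)) by (field; lra).
  apply Rinv_le_contravar; [lra|].
  pose proof (exp_ge_taylor (r / 3) 2 ltac:(lra)) as T. simpl in T.
  rewrite <- Hrr. nra.
Qed.

Lemma ex_series_resonant :
  ex_series (selected (fun k => resonant (S k)) (fun k => resonant_dec (S k))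
    (fun k => / INR (S k))).
Proof.
destruct resonant_gap as (c0 & Hc0 & Hgap).
set (c := Rmin c0 (/ 6)).
assert (Hc : 0 < c <= / 6) by (unfold c, Rmin; destruct (Rle_dec c0 (/ 6)); lra).
assert (Hcc0 : c <= c0) by apply Rmin_l.
destruct (nfloor_ex 1048576 ltac:(lra)) as [N0 HN0].
assert (Hpos : forall k, 0 < INR (S k)) by (intros; apply lt_0_INR; lia).
assert (Hsc : 0 < sqrt c) by (apply sqrt_lt_R0; lra).
assert (Hbig : forall k, (N0 <= k)%nat -> 1048576 <= INR (S k)).
{ intros k Hk. apply le_INR in Hk. rewrite S_INR. lra. }
(* Scaled so that the drop given by [inv_sqrt_ln_drop] is at least [1 / (m + 1)], which dominates
   the next selected term. *)
set (Phi := fun k => 12 / sqrt c * / sqrt (ln (INR (S k)))).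
assert (H12 : 0 < 12 / sqrt c) by (apply Rdiv_lt_0_compat; lra).
destruct (sparse_sum_bounded (fun k => resonant (S k)) (fun k => resonant_dec (S k))
  (fun k => / INR (S k)) Phi 1 (12 / sqrt c) N0) as [C HC].
- intros n; split; [now apply Rlt_le, Rinv_0_lt_compat|].
  rewrite <- Rinv_1. apply Rinv_le_contravar; [lra|].
  change 1 with (INR 1). apply le_INR; lia.
- intros n Hn. pose proof (Hbig n Hn).
  assert (HL : 1 <= ln (INR (S n))).
  { rewrite <- (ln_exp 1). apply Rcomplements.ln_le; [apply exp_pos|].
    pose proof exp_le_3; lra. }
  assert (Hs : 1 <= sqrt (ln (INR (S n)))) by (rewrite <- sqrt_1; now apply sqrt_le_1_alt).
  assert (0 < / sqrt (ln (INR (S n))) <= 1).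
  { split; [apply Rinv_0_lt_compat; lra|]. rewrite <- Rinv_1.
    apply Rinv_le_contravar; lra. }
  unfold Phi; nra.
- intros m n Hm Hmn Bm Bn. pose proof (Hbig m Hm).
  assert (G := Hgap (S m) (S n) ltac:(auto) ltac:(lia) Bm Bn).
  assert (HL : 0 <= ln (INR (S m)) ^ 3).
  { apply pow_le. rewrite <- ln_1. left. apply ln_increasing; lra. }
  assert (D := inv_sqrt_ln_drop c (INR (S m)) (INR (S n - S m)) Hc ltac:(lra)
    (pos_INR _) ltac:(apply Rle_trans with (2 := G); now apply Rmult_le_compat_r)).
  rewrite <- plus_INR in D. replace (S m + (S n - S m))%nat with (S n) in D by lia.
  unfold Phi. rewrite <- Rmult_minus_distr_l.
  apply Rle_trans with (12 / sqrt c * (sqrt c / 12 * / INR (S m))).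
  + replace (12 / sqrt c * (sqrt c / 12 * / INR (S m))) with (/ INR (S m))
      by (field; split; [apply Rgt_not_eq, Hpos | lra]).
    apply Rinv_le_contravar; [apply Hpos|]. apply le_INR; lia.
  + apply Rmult_le_compat_l; lra.
- apply (ex_series_bounded _ C); auto.
  intros n. unfold selected. destruct (resonant_dec (S n)); [|lra].
  now apply Rlt_le, Rinv_0_lt_compat.
Qed.

(* Coquelicot series start at 0, so the index k stands for n = k + 1. *)
Theorem theorem4 :
  ex_series (fun k : nat =>
    (2 / 3 + 1 / 3 * sin (INR (S k))) ^ (S k) / INR (S k)).
Proof.
(* Domination: the base lies in [[1/3, 1]], so a resonant term is at most [1 / n]; every other term
   is at most [18 / n^2]. *)
eapply (@ex_series_le R_AbsRing R_CompleteNormedModule);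
  [|exact (ex_series_plus _ _ ex_series_resonant (ex_series_inv_sqr 18 ltac:(lra)))].
intros k.
assert (Hpos : 0 < INR (S k)) by (apply lt_0_INR; lia).
pose proof (SIN_bound (INR (S k))) as Hs.
set (x := 2 / 3 + 1 / 3 * sin (INR (S k))).
assert (Hx0 : 0 <= x ^ S k) by (apply pow_le; unfold x; lra).
assert (Hx1 : x ^ S k <= 1).
{ rewrite <- (pow1 (S k)). apply pow_incr; unfold x; lra. }
assert (Hinv : 0 < / INR (S k)) by now apply Rinv_0_lt_compat.
change (Rabs (x ^ S k / INR (S k)) <= selected (fun k => resonant (S k))
  (fun k => resonant_dec (S k)) (fun k => / INR (S k)) k + 18 / INR (S k) ^ 2).
rewrite Rabs_right by (apply Rle_ge, Rmult_le_pos; lra).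
unfold selected; destruct (resonant_dec (S k)) as [|Hn].
- assert (0 <= 18 / INR (S k) ^ 2).
  { apply Rmult_le_pos; [lra|]. now apply Rlt_le, Rinv_0_lt_compat, pow_lt. }
  unfold Rdiv at 1. nra.
- replace (18 / INR (S k) ^ 2) with (18 / INR (S k) * / INR (S k))
    by (field; now apply Rgt_not_eq).
  rewrite Rplus_0_l. apply Rmult_le_compat_r; [lra|].
  apply nonresonant_term; auto; lia.
Qed.
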